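(* Let $(p_n)_{n\ge 1}$ be a sequence of tearing probabilities in $(0,1)$ such that the limit $\alpha = \lim_{n\to\infty} p_n \log n$ exists. Then the capacity of the torn-paper channel with tearing probabilities $(p_n)$ is $$C = e^{-\alpha}.$$
   Context: Logarithms $\log$ are base 2. The torn-paper channel with block length $n$ and tearing probability $p_n$ is defined as follows. The input is a binary string $X^n=(X_1,\dots,X_n)\in\{0,1\}^n$. Let $T_2,\dots,T_n$ be i.i.d. $\mathrm{Bernoulli}(p_n)$ random variables (independent of the input), $T_i$ indicating a cut between $X_{i-1}$ and $X_i$; equivalently, with $N_1,N_2,\dots$ i.i.d. $\mathrm{Geometric}(p_n)$ (support $\{1,2,\dots\}$, mean $1/p_n$) and $K$ the smallest index with $\sum_{i=1}^K N_i\ge n$, the input is cut into consecutive fragments $\vec X_i = (X_{1+\sum_{j<i}N_j},\dots,X_{\sum_{j\le i}N_j})$ for $i<K$ and $\vec X_K=(X_{1+\sum_{j<K}N_j},\dots,X_n)$. Given $K$, let $\pi$ be a uniformly random permutation of $\{1,\dots,K\}$; the channel output is the unordered collection $\mathcal Y=\{\vec Y_1,\dots,\vec Y_K\}$ with $\vec Y_i=\vec X_{\pi_i}$. A code of rate $R$ consists of $2^{nR}$ binary codewords of length $n$ and a decoder mapping the output collection to an estimate $\hat W\in\{1,\dots,2^{nR}\}$; the message $W$ is uniform on $\{1,\dots,2^{nR}\}$. A rate $R$ is achievable if there is a sequence of rate-$R$ codes with $n\to\infty$ whose error probability $\Pr(\hat W\ne W)$ tends to $0$; the capacity $C$ is the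 supremum of achievable rates. *)

(* Defs.v *)
From HB Require Import structures.
From mathcomp Require Import all_boot all_order all_algebra.
From mathcomp Require Import all_classical all_reals all_analysis.
Set Implicit Arguments. Unset Strict Implicit. Unset Printing Implicit Defensive.
Import Order.TTheory GRing.Theory Num.Theory.
Local Open Scope ring_scope.

(* tear x c : the list of consecutive fragments of the binary string x,
   where c i = true means there is a cut between x_i and x_{i+1}
   (0-indexed; c i for i >= size x - 1 is irrelevant). Fragments are listed
   in their original left-to-right order. *)
Fixpoint tear (x : seq bool) (c : nat -> bool) : seq (seq bool) :=
  match x with
  | [::] => [::]
  | a :: x' =>
      let r := tear x' (fun i => c i.+1) in
      if c 0%N || nilp x' then [:: a] :: r
      else (a :: head [::] r) :: behead r
  end.

(* Tearing pattern of a length-n string: T j (j < n-1) indicates a cut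
   between X_{j+1} and X_{j+2} (1-indexed), i.e. T_{j+2} of the paper. *)
Definition cutfun (n : nat) (T : {ffun 'I_n.-1 -> bool}) : nat -> bool :=
  fun i => match (insub i : option 'I_n.-1) with
           | Some j => T j
           | None => false
           end.

Definition tear_prob (R : realType) (p : R) (n : nat)
  (T : {ffun 'I_n.-1 -> bool}) : R :=
  \prod_(j < n.-1) (if T j then p else 1 - p).

(* A code of block length n: M messages, an encoder, and a decoder which sees
   only the unordered collection of fragments (i.e. it is invariant under
   permutations of the list of fragments). *)
Record code (n : nat) : Type := Code {
  nmsg : nat;
  enc : 'I_nmsg -> n.-tuple bool;
  dec : seq (seq bool) -> 'I_nmsg;
  dec_perm : forall s t, perm_eq s t -> dec s = dec t }.
Arguments nmsg {n}.
Arguments enc {n}.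
Arguments dec {n}.
Arguments dec_perm {n}.

(* Average error probability Pr(What <> W), W uniform, over the torn-paper
   channel with tearing probability p. Because the decoder is permutation
   invariant, the uniformly random permutation of fragments does not affect
   the decoder output, so it is applied to the fragments in original order. *)
Definition err (R : realType) (p : R) (n : nat) (C : code n) : R :=
  (nmsg C)%:R^-1 *
  \sum_(w : 'I_(nmsg C)) \sum_(T : {ffun 'I_n.-1 -> bool})
     tear_prob p T * (dec C (tear (enc C w) (cutfun T)) != w)%:R.

Definition achievable (R : realType) (p : nat -> R) (r : R) : Prop :=
  forall eps : R, 0 < eps -> exists N : nat, forall n : nat, (N <= n)%N ->
    exists C : code n, 2 `^ (n%:R * r) <= (nmsg C)%:R /\ err (p n) C <= eps.

Definition capacity (R : realType) (p : nat -> R) : R :=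
  sup [set r | achievable p r].

(* Main.v *)
Require Import Defs.
From HB Require Import structures.
From mathcomp Require Import all_boot all_order all_algebra.
From mathcomp Require Import all_classical all_reals all_analysis.
From mathcomp Require Import zify ring lra.
Import Order.TTheory GRing.Theory Num.Theory.
Import numFieldNormedType.Exports.
Local Open Scope ring_scope.
Local Open Scope classical_set_scope.

(** Both bounds rest on the excess [S_l], the sum over the fragments of
    [(length - l)^+].  It equals the number of length-[l] windows of
    consecutive potential cut positions that contain no cut, so its mean is
    [(n - l) (1 - p)^l], which is [n (e^-alpha + o(1))] when [l ~ log n], and
    its variance is at most [2 l n] since disjoint windows are independent.

    Achievability: take [l >= log n].  The strings that can be reassembled from
    given fragments are obtained by arranging the short fragments and inserting
    each fragment longer than [l] at one of at most [n <= 2^l] places, so there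
    are at most [2^(n - S_l)] of them.  Codewords picked one after the other so
    as to be rarely compatible with the outputs of their predecessors then give
    an error of about [P(S_l < s) + M 2^-s].

    Converse: take [l = log n - 4 log log n].  For a fixed cutting pattern the
    output multiset is determined by the number of fragments with each length
    and each prefix of length [l], together with the remaining bits of the
    fragments in the order of these keys.  The counts cost [o(n)] bits and the
    remaining bits number [S_l + o(n)], so Markov's inequality for [S_l] keeps
    the error away from [0] at rates above [e^-alpha]. *)

(** * Excess lengths of the fragments *)

Lemma flatten_tear x c : flatten (tear x c) = x.
Proof.
elim: x c => //= a x IH c; case: ifP => /= [_|]; first by rewrite IH.
have := IH (fun i => c i.+1); case: (tear x _) => [|u r] /= <- //.
Qed.

(** Once the cutting pattern is fixed, fragment lengths carry no information about the codeword; the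
    converse relies on this. *)
Lemma shape_tear x y c : size x = size y -> shape (tear x c) = shape (tear y c).
Proof.
elim: x y c => [|a x IH] [|b y] c //= [sxy].
have := IH y (fun i => c i.+1) sxy; rewrite /nilp sxy.
case: ifP => _ /=; first by move->.
by case: (tear x _) (tear y _) => [|u r] [|v s] //= [-> ->].
Qed.

Lemma head_tear_size m x c : (0 < m)%N ->
  (m < size (head [::] (tear x c)))%N =
  (m < size x)%N && [forall j : 'I_m, ~~ c j].
Proof.
elim: x m c => [|a x IH] m c m0 //=.
case: ifP => [|/norP[c0 xn]] /=.
  case/orP => [c0|]; last by case: x {IH} => //=; lia.
  rewrite ltnS leqNgt m0 /=; apply/esym/negbTE; rewrite negb_and; apply/orP; right.
  by rewrite negb_forall; apply/existsP; exists (Ordinal m0); rewrite negbK.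
case: m m0 => // m _; rewrite !ltnS.
have -> : [forall j : 'I_m.+1, ~~ c j] = [forall j : 'I_m, ~~ c j.+1].
  apply/forallP/forallP => [H j|H [[|j] jm]] //=.
    exact: H (lift ord0 j).
  exact: (H (Ordinal (jm : (j < m)%N))).
case: m => [|m]; last exact: IH.
have -> : [forall j : 'I_0, ~~ c j.+1] by apply/forallP => -[].
rewrite andbT.
case: x xn {IH} => // b x _.
rewrite /=; case: ifP => //.
Qed.

Definition excess l (s : seq (seq bool)) : nat := (\sum_(u <- s) (size u - l))%N.

(** An uncut window of [l] cut positions means [l + 1] consecutive letters in one fragment, and a
    fragment of length [m] holds [m - l] of these. In the induction, a new first letter adds one
    exactly when it makes the head fragment longer than [l]. *)
Lemma excess_tear l x c : (0 < l)%N -> excess l (tear x c) =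
  (\sum_(i < size x - l) [forall j : 'I_l, ~~ c (i + j)%N])%N.
Proof.
move=> l0; elim: x c => [|a x IH] c; first by rewrite /excess /= big_nil sub0n big_ord0.
have {}IH := IH (fun i => c i.+1).
have -> : (\sum_(i < size (a :: x) - l) [forall j : 'I_l, ~~ c (i + j)%N] =
   ((l < size (a :: x)) && [forall j : 'I_l, ~~ c j]) +
   \sum_(i < size x - l) [forall j : 'I_l, ~~ c (i + j).+1])%N.
  rewrite /=; case: (leqP l (size x)) => lx.
    by rewrite subSn // big_ord_recl /= ltnS lx.
  have -> : ((size x).+1 - l)%N = 0%N by apply/eqP; rewrite subn_eq0.
  have -> : (size x - l)%N = 0%N by apply/eqP; rewrite subn_eq0 ltnW.
  by rewrite !big_ord0 ltnS leqNgt lx.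
rewrite -IH -head_tear_size // /excess /=; case: ifP => [_|] /=.
  by rewrite big_cons /=; lia.
case: (tear x _) (flatten_tear x (fun i => c i.+1)) => [<-|u r _ _] /=.
  by rewrite orbT.
by rewrite !big_cons /=; lia.
Qed.

(** * Mean and variance of the number of uncut windows *)

Definition nocut {m} (T : {ffun 'I_m -> bool}) (A : {set 'I_m}) : bool :=
  [forall k in A, ~~ T k].

Definition window n l i : {set 'I_n.-1} := [set k : 'I_n.-1 | (i <= k < i + l)%N]%SET.

Definition nwin {n} l (T : {ffun 'I_n.-1 -> bool}) : nat :=
  (\sum_(i < n - l) nocut T (window n l i))%N.

Lemma cutfunE n (T : {ffun 'I_n.-1 -> bool}) (j : 'I_n.-1) : cutfun T j = T j.
Proof. by rewrite /cutfun valK. Qed.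

Lemma excess_nwin n l (T : {ffun 'I_n.-1 -> bool}) x : (0 < l)%N -> size x = n ->
  excess l (tear x (cutfun T)) = nwin l T.
Proof.
move=> l0 sx; rewrite excess_tear // sx; apply: eq_bigr => i _; congr nat_of_bool.
have il := ltn_ord i.
apply/forallP/forall_inP => [H k|H j].
  rewrite inE => /andP[ik kil]; have kl : (k - i < l)%N by lia.
  by have := H (Ordinal kl); rewrite /= subnKC // cutfunE.
have jl := ltn_ord j; have ij : (i + j < n.-1)%N by lia.
rewrite (cutfunE _ T (Ordinal ij)); apply: H; rewrite inE /=; lia.
Qed.

Lemma card_window n l i : (i < n - l)%N -> #|window n l i| = l.
Proof.
move=> il; have h (k : 'I_l) : (i + k < n.-1)%N by have := ltn_ord k; lia.
have -> : window n l i = [set Ordinal (h k) | k : 'I_l]%SET.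
  apply/setP => k; rewrite inE; apply/idP/imsetP => [/andP[ik kl]|[j _ ->]] /=.
    have kil : (k - i < l)%N by lia.
    by exists (Ordinal kil) => //; apply/val_inj; rewrite /= subnKC.
  by have := ltn_ord j; lia.
rewrite card_imset ?card_ord // => a b [] /addnI /val_inj //.
Qed.

Section TearProb.
Variables (R : realType) (p : R) (n : nat).
Implicit Type T : {ffun 'I_n.-1 -> bool}.

(** Weight and indicator both factor over positions: a position in [A] contributes [1 - p], any
    other contributes 1. *)
Lemma sum_tear_prob_nocut (A : {set 'I_n.-1}) :
  \sum_(T : {ffun 'I_n.-1 -> bool}) tear_prob p T * (nocut T A)%:R = (1 - p) ^+ #|A|.
Proof.
pose F (j : 'I_n.-1) (b : bool) : R :=
  (if b then p else 1 - p) * (if j \in A then (~~ b)%:R else 1).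
transitivity (\sum_(T : {ffun 'I_n.-1 -> bool}) \prod_j F j (T j)).
  apply: eq_bigr => T _; rewrite big_split /=; congr (_ * _).
  rewrite -big_mkcond /=.
  have [/forall_inP H|] := boolP (nocut T A).
    by rewrite big1 // => j /H ->.
  rewrite negb_forall => /existsP[j]; rewrite negb_imply negbK => /andP[jA Tj].
  by rewrite (bigD1 j) //= Tj mul0r.
rewrite -(bigA_distr_bigA F) -prodr_const [RHS]big_mkcond /=.
apply: eq_bigr => j _; rewrite big_bool /F /=; case: ifP => _; lra.
Qed.

Lemma sum_tear_prob : \sum_(T : {ffun 'I_n.-1 -> bool}) tear_prob p T = 1.
Proof.
rewrite -[RHS](expr0 (1 - p)) -(cards0 'I_n.-1) -sum_tear_prob_nocut.
apply: eq_bigr => T _; rewrite (_ : nocut T _) ?mulr1 //.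
by apply/forall_inP => j; rewrite inE.
Qed.

Lemma mean_nwin l :
  \sum_(T : {ffun 'I_n.-1 -> bool}) tear_prob p T * (nwin l T)%:R = (n - l)%:R * (1 - p) ^+ l.
Proof.
under eq_bigr do rewrite natr_sum mulr_sumr.
rewrite exchange_big /=.
under eq_bigr => i _ do rewrite sum_tear_prob_nocut card_window //.
by rewrite sumr_const card_ord mulr_natl.
Qed.

Hypotheses (p_ge0 : 0 <= p) (p_le1 : p <= 1).

Lemma tear_prob_ge0 T : 0 <= tear_prob p T.
Proof. by apply: prodr_ge0 => j _; case: ifP => _; rewrite ?subr_ge0. Qed.

Lemma nocutU T (A B : {set 'I_n.-1}) : nocut T (A :|: B)%SET = nocut T A && nocut T B.
Proof.
apply/forall_inP/andP => [H|[/forall_inP HA /forall_inP HB] k].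
  by split; apply/forall_inP => k kA; apply: H; rewrite inE kA ?orbT.
by rewrite inE => /orP[/HA|/HB].
Qed.

(** This counts the windows overlapping window [i]: their starts lie in an interval of [2 * l]
    integers. *)
Lemma sum_near_diag_le (N l i : nat) :
  (\sum_(j < N) ((i < j + l) && (j < i + l)) <= 2 * l)%N.
Proof.
rewrite -(big_mkord xpredT (fun j => nat_of_bool ((i < j + l) && (j < i + l)))%N).
rewrite -big_mkcond /= sum1_count -size_filter -[X in (_ <= X)%N](size_iota (i.+1 - l)).
apply: uniq_leq_size; first by rewrite filter_uniq // iota_uniq.
by move=> j; rewrite mem_filter !mem_iota => /andP[/andP[? ?] _]; lia.
Qed.

(** Chebyshev's inequality: the variance is a sum of covariances of window indicators, which vanish
    for disjoint windows and are at most 1 for overlapping ones. *)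
Lemma nwin_lower_tail l (t : R) : 0 < t ->
  \sum_(T : {ffun 'I_n.-1 -> bool}) tear_prob p T * ((nwin l T)%:R <= (n - l)%:R * (1 - p) ^+ l - t)%R%:R
  <= (n * (2 * l))%:R / t ^+ 2.
Proof.
move=> t0; set q := (1 - p) ^+ l; set mu := _ * q.
have q_ge0 : 0 <= q by rewrite exprn_ge0 ?subr_ge0.
apply: (@le_trans _ _ (\sum_(T : {ffun 'I_n.-1 -> bool}) tear_prob p T * ((nwin l T)%:R - mu) ^+ 2 / t ^+ 2)).
  apply: ler_sum => T _; rewrite -mulrA; apply: ler_wpM2l; first exact: tear_prob_ge0.
  case: (leP _ (mu - t)) => [h|_]; last first.
    by rewrite divr_ge0 ?sqr_ge0.
  rewrite ler_pdivlMr ?exprn_gt0 // mul1r -[leRHS]sqrrN lerXn2r ?nnegrE //; lra.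
rewrite -mulr_suml ler_wpM2r ?invr_ge0 ?sqr_ge0 //.
pose I (T : {ffun 'I_n.-1 -> bool}) (i : 'I_(n - l)) : R := (nocut T (window n l i))%:R.
have EI i : \sum_(T : {ffun 'I_n.-1 -> bool}) tear_prob p T * I T i = q.
  by rewrite sum_tear_prob_nocut card_window.
have -> : \sum_(T : {ffun 'I_n.-1 -> bool}) tear_prob p T * ((nwin l T)%:R - mu) ^+ 2 =
    \sum_(i < n - l) \sum_(j < n - l)
       \sum_(T : {ffun 'I_n.-1 -> bool}) tear_prob p T * ((I T i - q) * (I T j - q)).
  rewrite [RHS](eq_bigr (fun i : 'I_(n-l) => \sum_(T : {ffun 'I_n.-1 -> bool}) \sum_(j < n - l)
      tear_prob p T * ((I T i - q) * (I T j - q)))); last first.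
    by move=> i _; rewrite exchange_big.
  rewrite exchange_big /=; apply: eq_bigr => T _.
  under [RHS]eq_bigr => i _ do rewrite -mulr_sumr -mulr_sumr.
  rewrite -mulr_sumr -mulr_suml expr2; congr (_ * _).
  rewrite /nwin natr_sum /mu.
  have -> : (n - l)%:R * q = \sum_(i < n - l) q by rewrite sumr_const card_ord mulr_natl.
  by rewrite -sumrB.
apply: (@le_trans _ _ (\sum_(i < n - l) \sum_(j < n - l)
    ((i < j + l)%N && (j < i + l)%N)%:R)); last first.
  rewrite (_ : (n * (2 * l))%:R = \sum_(i < n) (2 * l)%:R); last first.
    by rewrite sumr_const card_ord (mulnC n) mulrnA.
  apply: (@le_trans _ _ (\sum_(i < n - l) (2 * l)%:R)).
    by apply: ler_sum => i _; rewrite -natr_sum ler_nat sum_near_diag_le.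
  by rewrite !sumr_const !card_ord -!mulrnA ler_nat leq_mul2l leq_subr orbT.
apply: ler_sum => i _; apply: ler_sum => j _.
have -> : \sum_(T : {ffun 'I_n.-1 -> bool}) tear_prob p T * ((I T i - q) * (I T j - q)) =
    (1 - p) ^+ #|window n l i :|: window n l j|%SET - q ^+ 2.
  rewrite -sum_tear_prob_nocut.
  have -> : q ^+ 2 = \sum_(T : {ffun 'I_n.-1 -> bool}) tear_prob p T * (q * I T i + q * I T j - q ^+ 2).
    under eq_bigr do rewrite mulrBr mulrDr !(mulrCA _ q).
    by rewrite sumrB big_split /= -!mulr_sumr !EI -mulr_suml sum_tear_prob; ring.
  rewrite -sumrB; apply: eq_bigr => T _; rewrite nocutU -mulnb natrM -/(I T i) -/(I T j); ring.
have le1 A : (1 - p) ^+ #|A : {set 'I_n.-1}| <= 1 by rewrite exprn_ile1 ?subr_ge0 // gerBl.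
case: (boolP (_ && _)) => [_|far];
  first by have := le1 (window n l i :|: window n l j)%SET; have := sqr_ge0 q; rewrite /=; lra.
rewrite cardsU (_ : _ :&: _ = finset.set0)%SET; last first.
  by apply/setP => k; rewrite !inE; lia.
by rewrite cards0 subn0 !card_window // exprD expr2 subrr.
Qed.

End TearProb.

(** * Random-coding bound *)

Lemma perm_flatten_insert (u : seq bool) s s' : perm_eq s' (u :: s) ->
  exists s1 i, [/\ perm_eq s1 s, (i <= size (flatten s1))%N &
    flatten s' = take i (flatten s1) ++ u ++ drop i (flatten s1)].
Proof.
move=> pe; have us : u \in s' by rewrite (perm_mem pe) mem_head.
case/splitPr: us pe => a b; rewrite perm_catC /= perm_cons perm_catC => pe.
exists (a ++ b), (size (flatten a)); split => //.
  by rewrite flatten_cat size_cat leq_addr.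
by rewrite !flatten_cat take_size_cat // drop_size_cat.
Qed.

(** Short fragments are charged their full length, since all strings of their total length are
    listed. Each long fragment is charged only [l] bits, for its place of insertion. *)
Lemma flatten_perm_bound l (s : seq (seq bool)) : (size (flatten s) <= 2 ^ l)%N ->
  exists L : seq (seq bool), (size L <= 2 ^ (\sum_(u <- s) minn (size u) l))%N /\
    forall s', perm_eq s' s -> flatten s' \in L.
Proof.
suff H s1 s2 : all (fun u => l < size u)%N s1 -> all (fun u => size u <= l)%N s2 ->
    (size (flatten (s1 ++ s2)) <= 2 ^ l)%N ->
    exists L : seq (seq bool), (size L <= 2 ^ (\sum_(u <- s1 ++ s2) minn (size u) l))%N /\
    forall s', perm_eq s' (s1 ++ s2) -> flatten s' \in L.
  pose long (u : seq bool) := (l < size u)%N.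
  have pe : perm_eq (seq.filter long s ++ seq.filter (predC long) s) s.
    by rewrite perm_filterC.
  move=> sz; case: (H (seq.filter long s) (seq.filter (predC long) s)).
  - exact: filter_all.
  - by rewrite all_filter; apply/allP => u _ /=; rewrite /long -leqNgt implybb.
  - by rewrite (perm_size (perm_flatten pe)).
  - move=> L [sL hL]; exists L; split; first by rewrite -(perm_big _ pe).
    by move=> s' pe'; apply: hL; rewrite (permPr pe).
elim: s1 => [_ short _|u s1 IH /= /andP[ul long] short sz].
  exists [seq val t | t <- enum {: (size (flatten s2)).-tuple bool}]; split.
    rewrite size_map -cardT card_tuple card_bool leq_exp2l //=.
    rewrite size_flatten /shape sumnE big_map; apply/eq_leq/eq_big_seq => v vs.
    by rewrite (minn_idPl _) //; exact: (allP short).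
  move=> s' pe; have e : size (flatten s') == size (flatten s2).
    by apply/eqP/perm_size/perm_flatten.
  by apply/mapP; exists (Tuple e); rewrite ?mem_enum.
have [|L [sL hL]] := IH long short.
  by apply: leq_trans sz; rewrite size_cat leq_addl.
exists [seq take i x ++ u ++ drop i x | x <- L, i <- iota 0 (2 ^ l)]; split.
  rewrite size_allpairs size_iota big_cons (minn_idPr (ltnW ul)) expnD mulnC.
  by rewrite leq_mul2l sL orbT.
move=> s' /perm_flatten_insert[s0 [i [pe ile ->]]].
apply/allpairsP; exists (flatten s0, i); split => //=; first exact: hL.
(* The inserted [u] is nonempty, so the string it is inserted into is shorter than [2 ^ l], and [i]
   falls in the range strictly. *)
rewrite mem_iota add0n; apply: leq_ltn_trans ile _.
rewrite (perm_size (perm_flatten pe)); apply: leq_trans sz.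
by rewrite size_cat -[X in (X < _)%N]add0n ltn_add2r (leq_ltn_trans _ ul).
Qed.

Definition compat (x : seq bool) (s : seq (seq bool)) : bool :=
  has (fun s' => flatten s' == x) (permutations s).

Lemma compat_perm x s t : perm_eq s t -> compat x s = compat x t.
Proof.
by move=> st; apply: eq_has_r => s'; rewrite !mem_permutations (permPr st).
Qed.

Lemma compat_tear x c : compat x (tear x c).
Proof.
by apply/hasP; exists (tear x c); rewrite ?flatten_tear // mem_permutations.
Qed.

(** The length [n] splits into the lengths truncated at [l] and the excess, so the exponent in
    [flatten_perm_bound] is [n - nwin l T]. *)
Lemma card_compat n l (T : {ffun 'I_n.-1 -> bool}) (x : n.-tuple bool) :
  (0 < l)%N -> (n <= 2 ^ l)%N ->
  (#|[pred y : n.-tuple bool | compat y (tear x (cutfun T))]| * 2 ^ nwin l T <= 2 ^ n)%N.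
Proof.
move=> l0 nl; set s := tear _ _.
have sz : size (flatten s) = n by rewrite flatten_tear size_tuple.
have [|L [sL hL]] := @flatten_perm_bound l s; first by rewrite sz.
have nE : n = (\sum_(u <- s) minn (size u) l + nwin l T)%N.
  rewrite -(@excess_nwin n l T x) ?size_tuple // /excess -/s -big_split /=.
  rewrite -{1}sz size_flatten /shape sumnE big_map; apply: eq_bigr => u _; lia.
rewrite [X in (_ <= 2 ^ X)%N]nE expnD leq_mul2r; apply/orP; right; apply: leq_trans sL.
rewrite cardE -(size_map val); apply: uniq_leq_size.
  by rewrite map_inj_uniq ?enum_uniq //; exact: val_inj.
move=> y /mapP[z]; rewrite mem_enum inE => /hasP[s'].
by rewrite mem_permutations => /hL sL' /eqP zE -> /=; rewrite -zE.
Qed.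

(* The new element goes in front, so that it is only compared with the elements
   of larger index; accordingly the decoder in [exists_code] returns the first
   compatible codeword. *)
Lemma greedy_seq (R : realFieldType) (X : finType) (x0 : X) (h : X -> X -> R) (q : R) (M : nat) :
  0 <= q -> (forall x, \sum_y h x y <= #|X|%:R * q) ->
  exists xs : seq X, size xs = M /\
    \sum_(w < M) \sum_(j < w) h (nth x0 xs w) (nth x0 xs j) <= M%:R ^+ 2 * q.
Proof.
move=> q0 hq; elim: M => [|M [xs [sxs IH]]].
  by exists [::]; rewrite big_ord0 expr0n mul0r.
(* By averaging: if every [y] exceeded the bound, so would the sum over [y], against [hq]. *)
have [y hy] : exists y, \sum_(w < M) h (nth x0 xs w) y <= M%:R * q.
  apply: contrapT => /forallNP no.
  have : \sum_y \sum_(w < M) h (nth x0 xs w) y > \sum_(y : X) M%:R * q.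
    apply: ltr_sum; first by apply/hasP; exists x0 => //; rewrite mem_index_enum.
    by move=> y _; rewrite ltNge; apply/negP/no.
  rewrite exchange_big /= ltNge => /negP; apply.
  rewrite (_ : \sum_(y : X) _ = \sum_(w < M) (#|X|%:R * q)).
    by apply: ler_sum => w _; exact: hq.
  by rewrite !sumr_const card_ord -[LHS]mulr_natl -[RHS]mulr_natl mulrCA.
exists (y :: xs); split; first by rewrite /= sxs.
rewrite big_ord_recl big_ord0 add0r.
under eq_bigr => w _ do rewrite /= big_ord_recl /=.
rewrite big_split /=.
apply: le_trans (lerD hy IH) _.
rewrite -natr1; have : 0 <= M%:R * q by rewrite mulr_ge0.
nra.
Qed.

(** Patterns with [nwin l T < s0] are counted as errors. For the others at most a fraction 2^(-s0)
    of all strings is compatible with a given output, so [greedy_seq] bounds the total confusion by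
    (m + 1)^2 2^(-s0), and averaging over the messages removes one factor [m + 1]. *)
Lemma exists_code (R : realType) (p : R) n l (s0 : R) m :
  0 <= p -> p <= 1 -> (0 < l)%N -> (n <= 2 ^ l)%N ->
  exists C : Defs.code n, nmsg C = m.+1 /\
    err p C <= \sum_(T : {ffun 'I_n.-1 -> bool}) tear_prob p T * ((nwin l T)%:R < s0)%R%:R
      + m.+1%:R * 2 `^ (- s0).
Proof.
move=> p0 p1 l0 nl.
pose X := n.-tuple bool.
pose good (T : {ffun 'I_n.-1 -> bool}) := s0 <= (nwin l T)%:R.
pose h (x y : X) : R := \sum_(T : {ffun 'I_n.-1 -> bool})
  tear_prob p T * (good T && compat y (tear x (cutfun T)))%:R.
pose x0 : X := [tuple of nseq n false].
have [||xs [sxs hxs]] := @greedy_seq R X x0 h (2 `^ (- s0)) m.+1; first exact: powR_ge0.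
  move=> x; rewrite exchange_big /=.
  suff : \sum_(T : {ffun 'I_n.-1 -> bool}) \sum_(y : X)
        tear_prob p T * (good T && compat y (tear x (cutfun T)))%:R <=
      (\sum_(T : {ffun 'I_n.-1 -> bool}) tear_prob p T) * (#|{: X}|%:R * 2 `^ (- s0)).
    by rewrite sum_tear_prob mul1r.
  rewrite mulr_suml; apply: ler_sum => T _.
  rewrite -mulr_sumr; apply: ler_wpM2l; first exact: tear_prob_ge0.
  have [gT|_] := boolP (good T); last first.
    by rewrite big1 // mulr_ge0 ?powR_ge0.
  rewrite -natr_sum -big_mkcond sum1_card /=.
  rewrite powRN ler_pdivlMr ?powR_gt0 // card_tuple card_bool.
  apply: (@le_trans _ _ (#|[pred y : X | compat y (tear x (cutfun T))]|%:R * 2 `^ (nwin l T)%:R)).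
    by apply: ler_wpM2l => //; apply: ler_powR => //; rewrite ler1n.
  rewrite powR_mulrn // -natrX -natrM ler_nat.
  exact: card_compat.
have dec_perm s t : perm_eq s t ->
    inord (find (fun x : X => compat x s) xs) = inord (find (fun x : X => compat x t) xs) :> 'I_m.+1.
  by move=> st; congr inord; apply: eq_find => x; exact: compat_perm.
exists (@Code n m.+1 (fun w => nth x0 xs w) (fun s => inord (find (fun x : X => compat x s) xs)) dec_perm).
split => //; rewrite /err /=.
rewrite ler_pdivrMl // mulrDr.
set bad := \sum_(T : {ffun 'I_n.-1 -> bool}) _.
apply: (@le_trans _ _ (\sum_(w < m.+1) (bad + \sum_(j < w) h (nth x0 xs w) (nth x0 xs j)))); last first.
  rewrite big_split /= sumr_const card_ord -[bad *+ _]mulr_natl lerD2l.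
  by rewrite mulrA -expr2.
apply: ler_sum => w _; rewrite /h exchange_big -big_split /=; apply: ler_sum => T _.
rewrite -mulr_sumr -mulrDr; apply: ler_wpM2l; first exact: tear_prob_ge0.
rewrite -natr_sum -natrD ler_nat ltNge -/(good T).
case: (good T) => /=; last by rewrite (leq_trans (leq_b1 _)) // leq_addr.
rewrite add0n.
case: (boolP [exists j : 'I_w, compat (nth x0 xs j) (tear (nth x0 xs w) (cutfun T))]).
  case/existsP => j cj; rewrite (bigD1 j) //= cj.
  by rewrite (leq_trans (leq_b1 _)) // leq_addr.
move=> /existsPn nex; set P := fun x : X => _.
have wx : (w < size xs)%N by rewrite sxs.
(* The sent word is compatible with its own output and no codeword of smaller index is, so the
   search stops at [w]. *)
have -> : find P xs = w.
  apply/eqP; rewrite eqn_leq; apply/andP; split.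
    rewrite leqNgt; apply/negP => /(before_find x0).
    by rewrite /P compat_tear.
  rewrite leqNgt; apply/negP => fw.
  have := nex (Ordinal fw); rewrite /= -/(P _) nth_find //.
  by rewrite has_find (ltn_trans fw).
by rewrite inord_val eqxx.
Qed.

(** * Counting outputs for a fixed cutting pattern *)

Lemma size_tear x c : (size (tear x c) <= size x)%N.
Proof.
elim: x c => //= a x IH c; have := IH (fun i => c i.+1).
by case: ifP => _ //=; case: (tear x _) => [|u r] /= ?; lia.
Qed.

Section Signature.
Variables (l K : nat).

(** Padding puts all prefixes in one finite type, so that their counts form a finite function; the
    length stored in [key] recovers the true prefix. *)
Definition pad (u : seq bool) : l.-tuple bool := [tuple nth false u i | i < l].

(* Fragments longer than [K] are too rare for their prefixes to matter: all
   their bits go to [rest], and only lengths up to [K] need prefix counts. *)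
Definition key (u : seq bool) : nat * seq bool :=
  if (size u <= K)%N then (size u, val (pad u)) else (size u, [::]).

Definition rest (u : seq bool) : seq bool := if (size u <= K)%N then drop l u else u.

Lemma pad_drop u : take (size u) (pad u) ++ drop l u = u.
Proof.
rewrite -[RHS](cat_take_drop l u); congr cat.
apply: (@eq_from_nth _ false); first by rewrite !size_take size_tuple; do 2 case: ltnP => ?; lia.
move=> i; rewrite size_take size_tuple => il.
have [iu il'] : (i < size u)%N /\ (i < l)%N by move: il; case: (ltnP (size u) l) => ? ?; lia.
by rewrite !nth_take // -[i]/(nat_of_ord (Ordinal il')) -tnth_nth tnth_mktuple.
Qed.

Lemma key_rest_inj u v : key u = key v -> rest u = rest v -> u = v.
Proof.
rewrite /key /rest; case: (leqP (size u)) => uK; case: (leqP (size v)) => vK //.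
- move=> e ruv; have suv : size u = size v := congr1 fst e.
  have puv : tval (pad u) = pad v := congr1 snd e.
  by rewrite -(pad_drop u) -(pad_drop v) suv puv ruv.
- by move=> [suv _]; lia.
- by move=> [suv _]; lia.
Qed.

Lemma size_rest u : size (rest u) = if (size u <= K)%N then (size u - l)%N else size u.
Proof. by rewrite /rest; case: ifP => _; rewrite ?size_drop. Qed.

Lemma key_size u : (key u).1 = size u. Proof. by rewrite /key; case: ifP. Qed.

(* Any total order on keys will do: the multiset of keys then determines their
   sequence in the sorted list. *)
Definition keysort : seq (seq bool) -> seq (seq bool) :=
  sort (relpre (fun u => pickle (key u)) leq).

(** Equal key multisets give equal sorted key sequences. The length of a [rest] is a function of the
    key, so both concatenations are cut back at the same places, and each fragment is recovered from
    its key and rest. *)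
Lemma perm_from_key_rest s t : perm_eq (map key s) (map key t) ->
  flatten (map rest (keysort s)) = flatten (map rest (keysort t)) -> perm_eq s t.
Proof.
move=> pk fr; pose lek : rel (nat * seq bool) := relpre pickle leq.
have lek_sort r : map key (keysort r) = sort lek (map key r) by rewrite sort_map.
have ks : map key (keysort s) = map key (keysort t).
  rewrite !lek_sort; apply/perm_sortP => //; rewrite /lek.
  - by move=> a b; exact: leq_total.
  - by move=> a b c; exact: leq_trans.
  - move=> a b; rewrite /= => /anti_leq; exact: (pcan_inj pickleK).
have rs : map rest (keysort s) = map rest (keysort t).
  apply: eq_from_flatten_shape fr _; rewrite /shape -!map_comp.
  have E r : map (size \o rest) r =
      map (fun k : nat * seq bool => if (k.1 <= K)%N then (k.1 - l)%N else k.1) (map key r).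
    by rewrite -map_comp; apply: eq_map => u /=; rewrite size_rest key_size.
  by rewrite !E ks.
rewrite -(permPl (permEl (perm_sort (relpre (fun u => pickle (key u)) leq) s))).
rewrite -(permPr (permEl (perm_sort (relpre (fun u => pickle (key u)) leq) t))).
rewrite -/(keysort s) -/(keysort t).
suff -> : keysort s = keysort t by [].
elim: (keysort s) (keysort t) ks rs => [|u r IH] [|v r'] //= [ku kr] [ru rr].
by rewrite (key_rest_inj _ _ ku ru) (IH r').
Qed.

(** Keys of fragments longer than [K] record only the length, which the shape determines; all other
    keys are covered by the assumed counts. *)
Lemma perm_key s t : shape s = shape t ->
  (forall (k : 'I_K.+1) v, count (fun u => (size u == k) && (pad u == v)) s =
     count (fun u => (size u == k) && (pad u == v)) t) ->
  perm_eq (map key s) (map key t).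
Proof.
move=> sh cnt; apply/allP => -[k v] _; apply/eqP; rewrite !count_map /=.
have [kK|kK] := leqP k K; last first.
  have E r : count (preim key (pred1 (k, v))) r = count (fun m => (m == k) && (v == [::])) (shape r).
    rewrite count_map; apply: eq_count => u /=; rewrite /key.
    case: (leqP (size u)) => uK; rewrite xpair_eqE; last by rewrite [_ == v]eq_sym.
    by have -> : (size u == k) = false by apply/eqP; lia.
  by rewrite !E sh.
have [sv|sv] := eqVneq (size v) l; last first.
  have E r : count (preim key (pred1 (k, v))) r = 0%N.
    apply/eqP; rewrite -leqn0 leqNgt -has_count; apply/hasPn => u _ /=.
    rewrite /key; case: (leqP (size u)) => uK; rewrite xpair_eqE.
      apply/negP => /andP[_ /eqP e]; move: sv; rewrite -e size_tuple eqxx //.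
    by have -> : (size u == k) = false by apply/eqP; lia.
  by rewrite !E.
have E r : count (preim key (pred1 (k, v))) r =
    count (fun u => (size u == Ordinal (kK : (k < K.+1)%N)) && (pad u == tcast sv (in_tuple v))) r.
  apply: eq_count => u /=; rewrite /key.
  have -> : (pad u == tcast sv (in_tuple v)) = (tval (pad u) == v).
    by rewrite -(inj_eq val_inj) /= val_tcast.
  case: (leqP (size u)) => uK; rewrite xpair_eqE //.
  by have -> : (size u == k) = false by apply/eqP; lia.
by rewrite !E cnt.
Qed.

Lemma size_flatten_rest s : size (flatten (map rest (keysort s))) =
  (\sum_(m <- shape s) (if m <= K then m - l else m))%N.
Proof.
rewrite size_flatten /shape sumnE !big_map.
under [RHS]eq_bigr do rewrite -size_rest.
by apply: perm_big; exact: permEl (perm_sort _ _).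
Qed.

End Signature.

(** Correctly decoded codewords with the same signature have outputs that are permutations of each
    other, hence are equal messages. So they number at most the signatures: one count in 0..n per
    length and padded prefix, plus the remaining bits. *)
Lemma card_correct n l (C : Defs.code n) (T : {ffun 'I_n.-1 -> bool}) : (0 < l)%N ->
  (\sum_(w < nmsg C) (dec C (tear (enc C w) (cutfun T)) == w) <=
   n.+1 ^ ((l ^ 2).+1 * 2 ^ l) * 2 ^ (nwin l T + n %/ l))%N.
Proof.
(* A fragment longer than [K] keeps its first [l] bits in [rest]; these are at most a fraction 1/l
   of it, hence at most [n %/ l] bits in total. *)
move=> l0; pose K := (l ^ 2)%N; pose B := (nwin l T + n %/ l)%N.
pose fr (w : 'I_(nmsg C)) := tear (enc C w) (cutfun T).
pose sig w : {ffun 'I_K.+1 * l.-tuple bool -> 'I_n.+1} * {ffun 'I_B -> bool} :=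
  ([ffun kv : 'I_K.+1 * l.-tuple bool => inord (count (fun u => (size u == kv.1) && (pad l u == kv.2)) (fr w))],
   [ffun i : 'I_B => nth false (flatten (map (rest l K) (keysort l K (fr w)))) i]).
have frn w : (size (fr w) <= n)%N by rewrite (leq_trans (size_tear _ _)) ?size_tuple.
have sz w : (size (flatten (map (rest l K) (keysort l K (fr w)))) <= B)%N.
  rewrite size_flatten_rest big_map.
  have fn : (\sum_(u <- fr w) size u = n)%N.
    rewrite -[RHS](size_tuple (enc C w)) -[in RHS](flatten_tear (enc C w) (cutfun T)).
    by rewrite size_flatten /shape sumnE big_map.
  rewrite /B -(@excess_nwin n l T (enc C w)) ?size_tuple // -leq_subLR leq_divRL //.
  rewrite mulnBl leq_subLR -[X in (_ <= _ + X)%N]fn /excess -/(fr w) !big_distrl -big_split /=.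
  apply: leq_sum => u _; case: (leqP (size u) K) => uK; first by rewrite leq_addr.
  move: uK; rewrite /K expnS expn1; nia.
have inj : {in [pred w | dec C (fr w) == w] &, injective sig}.
  move=> w w'; rewrite !inE => /eqP cw /eqP cw' [s1 s2].
  rewrite -cw -cw'; apply: dec_perm; apply: (perm_from_key_rest l K).
    apply: perm_key; first by apply: shape_tear; rewrite !size_tuple.
    move=> k v; have := congr1 (fun f : {ffun _ -> 'I_n.+1} => val (f (k, v))) s1; rewrite !ffunE /= !inordK //.
      by rewrite ltnS (leq_trans (count_size _ _)).
    by rewrite ltnS (leq_trans (count_size _ _)).
  (* Both bit strings have the same length, so filling up with [false] to length [B] loses
     nothing. *)
  apply: (@eq_from_nth _ false).
    by rewrite !size_flatten_rest (shape_tear _ (enc C w')) ?size_tuple.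
  move=> i iw; have := congr1 (fun f : {ffun 'I_B -> bool} => f (Ordinal (leq_trans iw (sz w)))) s2.
  by rewrite !ffunE.
rewrite -big_mkcond sum1_card -(card_in_imset inj) /=.
apply: leq_trans (max_card _) _.
by rewrite card_prod !card_ffun card_prod card_tuple card_bool !card_ord.
Qed.

Lemma nmsg_gt0 n (C : Defs.code n) : (0 < nmsg C)%N.
Proof. exact: leq_ltn_trans (ltn_ord (dec C [::])). Qed.

(** Patterns with [nwin l T >= t] are handled by Markov's inequality; for any other pattern
    [card_correct] bounds the share of codewords decoded correctly. *)
Lemma err_lower_bound (R : realType) (p t : R) n l (C : Defs.code n) :
  0 <= p -> p <= 1 -> (0 < l)%N -> 0 < t ->
  1 - err p C <= (n - l)%:R * (1 - p) ^+ l / t +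
    (n.+1 ^ ((l ^ 2).+1 * 2 ^ l) * 2 ^ (n %/ l))%:R * 2 `^ t / (nmsg C)%:R.
Proof.
move=> p0 p1 l0 t0; have M0 : 0 < (nmsg C)%:R :> R by rewrite ltr0n nmsg_gt0.
set A : R := (_ * 2 ^ (n %/ l))%:R; set M : R := (nmsg C)%:R.
pose ok w (T : {ffun 'I_n.-1 -> bool}) := dec C (tear (enc C w) (cutfun T)) == w.
have -> : 1 - err p C = M^-1 *
    \sum_(T : {ffun 'I_n.-1 -> bool}) tear_prob p T * (\sum_w ok w T)%:R.
  have one : 1 = M^-1 * \sum_(w < nmsg C) \sum_(T : {ffun 'I_n.-1 -> bool}) tear_prob p T.
    by rewrite sum_tear_prob sumr_const card_ord mulVf // gt_eqF.
  rewrite [X in X - _]one /err -mulrBr -sumrB; congr (_ * _).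
  under [RHS]eq_bigr do rewrite natr_sum mulr_sumr.
  rewrite [RHS]exchange_big /=; apply: eq_bigr => w _.
  rewrite -sumrB; apply: eq_bigr => T _; rewrite /ok.
  by case: eqP => _ /=; rewrite ?mulr1 ?mulr0 ?subr0 ?subrr.
have -> : (n - l)%:R * (1 - p) ^+ l / t + A * 2 `^ t / M = M^-1 *
    \sum_(T : {ffun 'I_n.-1 -> bool}) tear_prob p T * (M * ((nwin l T)%:R / t) + A * 2 `^ t).
  rewrite -mean_nwin.
  have -> : \sum_(T : {ffun 'I_n.-1 -> bool})
      tear_prob p T * (M * ((nwin l T)%:R / t) + A * 2 `^ t) =
    \sum_(T : {ffun 'I_n.-1 -> bool})
      (M / t * (tear_prob p T * (nwin l T)%:R) + tear_prob p T * (A * 2 `^ t)).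
    by apply: eq_bigr => T _; ring.
  rewrite big_split /= -mulr_sumr -mulr_suml sum_tear_prob.
  by field; rewrite /M !gt_eqF.
apply: ler_wpM2l; first by rewrite invr_ge0 ltW.
apply: ler_sum => T _; apply: ler_wpM2l; first exact: tear_prob_ge0.
have [tS|St] := leP t (nwin l T)%:R.
  apply: (@le_trans _ _ (M * ((nwin l T)%:R / t))); last first.
    by rewrite lerDl mulr_ge0 ?powR_ge0.
  apply: (@le_trans _ _ M); last by rewrite ler_pMr // ler_pdivlMr ?mul1r.
  rewrite ler_nat -[X in (_ <= X)%N]card_ord -sum1_card leq_sum // => w _.
  exact: leq_b1.
apply: (@le_trans _ _ (A * 2 `^ t)); last first.
  by rewrite lerDr mulr_ge0 ?ler0n // divr_ge0 ?ler0n // ltW.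
apply: (@le_trans _ _ (A * 2 `^ (nwin l T)%:R)); last first.
  by apply: ler_wpM2l => //; apply: ler_powR; rewrite ?ler1n // ltW.
rewrite powR_mulrn // -natrX -natrM ler_nat -mulnA -expnD addnC.
exact: card_correct.
Qed.

(** This fixes the 4 in [4 * b]. With [a = trunc_log 2 n], one factor [a + 1] bounds the bits per
    count, two bound [l ^ 2 + 1], one bounds the divisor [l], and
    [(a + 1) ^ 4 * 2 ^ l <= 2 ^ a <= n]. *)
Lemma key_count_exponent n l b : (0 < l)%N -> b = up_log 2 (trunc_log 2 n).+1 ->
  (l + 4 * b)%N = trunc_log 2 n ->
  (n.+1 ^ ((l ^ 2).+1 * 2 ^ l) * 2 ^ (n %/ l) <= 2 ^ (2 * (n %/ l)))%N.
Proof.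
set a := trunc_log 2 n => l0 bE la.
have n0 : (0 < n)%N by rewrite lt0n; apply/eqP => n0; move: la; rewrite /a n0 trunc_log0; lia.
have [an na] := andP (@trunc_log_bounds 2 n isT n0).
have ab : (a.+1 <= 2 ^ b)%N by rewrite bE up_logP.
rewrite mul2n -addnn expnD leq_mul2r; apply/orP; right.
apply: leq_trans (_ : (2 ^ a.+1) ^ ((l ^ 2).+1 * 2 ^ l) <= _)%N.
  by rewrite leq_exp2r //; rewrite muln_gt0 expn_gt0.
rewrite -expnM leq_exp2l // leq_divRL //.
apply: leq_trans an; rewrite -/a -la expnD mulnC [(4 * b)%N]mulnC expnM.
apply: leq_trans (_ : 2 ^ l * a.+1 ^ 4 <= _)%N; last by rewrite leq_mul2l leq_exp2r ?ab ?orbT.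
rewrite -[(b * 4)%N]mulnC la.
have la1 : (l <= a.+1)%N by lia.
have l2 : ((l ^ 2).+1 <= a.+1 ^ 2)%N by rewrite !expnS !expn0; nia.
have -> : (2 ^ l * a.+1 ^ 4 = a.+1 * (a.+1 * (a.+1 ^ 2 * 2 ^ l)))%N by ring.
by rewrite !leq_mul.
Qed.

(** * Asymptotics *)

Section Log2.
Variable R : realType.

Lemma ln2_gt0 : 0 < ln (2 : R).
Proof. by rewrite ln_gt0 // ltr1n. Qed.

Lemma log2_le_pow n l : (0 < n)%N -> (n <= 2 ^ l)%N -> ln n%:R / ln 2 <= l%:R :> R.
Proof.
move=> n0 nl; rewrite ler_pdivrMr ?ln2_gt0 // mulr_natl -lnXn //.
by rewrite ler_ln ?posrE ?exprn_gt0 ?ltr0n // -natrX ler_nat.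
Qed.

Lemma pow_le_log2 n l : (2 ^ l <= n)%N -> l%:R <= ln n%:R / ln 2 :> R.
Proof.
move=> le_n; have n0 : (0 < n)%N by apply: leq_trans le_n; rewrite expn_gt0.
rewrite ler_pdivlMr ?ln2_gt0 // mulr_natl -lnXn //.
by rewrite ler_ln ?posrE ?exprn_gt0 ?ltr0n // -natrX ler_nat.
Qed.

Lemma up_log_le_log2 n : (1 < n)%N -> (up_log 2 n)%:R <= ln n%:R / ln 2 + 1 :> R.
Proof.
move=> n1; have /andP[lt _] := up_log_bounds (isT : (1 < 2)%N) n1.
have u0 : (0 < up_log 2 n)%N by rewrite up_log_gt0.
by rewrite -(prednK u0) -natr1 lerD2r pow_le_log2 // ltnW.
Qed.

Lemma log2_le_trunc_log n : (0 < n)%N -> ln n%:R / ln 2 <= (trunc_log 2 n)%:R + 1 :> R.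
Proof.
move=> n0; rewrite natr1 log2_le_pow // ltnW //.
by have /andP[] := trunc_log_bounds (isT : (1 < 2)%N) n0.
Qed.

Lemma trunc_log_le_log2 n : (0 < n)%N -> (trunc_log 2 n)%:R <= ln n%:R / ln 2 :> R.
Proof.
move=> n0; rewrite pow_le_log2 //.
by have /andP[] := trunc_log_bounds (isT : (1 < 2)%N) n0.
Qed.

Lemma trunc_log_near (K : nat) : \forall n \near \oo, (K <= trunc_log 2 n)%N.
Proof.
exists (2 ^ K)%N => // n /= Kn.
by rewrite -(@trunc_expnK 2 K) // leq_trunc_log.
Qed.

Lemma sqr_le_exp2 v : (v ^ 2 <= 2 * 2 ^ v)%N.
Proof.
have [|v4] := leqP v 3; first by case: v => [|[|[|[|]]]].
elim: v v4 => // v IH; rewrite ltnS leq_eqVlt => /predU1P[<- //|/IH].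
by rewrite !expnS expn0; case: v {IH} => [|[|[|v]]] //; nia.
Qed.

(** The logarithm [v] satisfies [v ^ 2 <= 4 * m], and [K] is chosen so that [4 <= e * v]; then [v]
    cancels. *)
Lemma up_log_small (e : R) : 0 < e ->
  \forall m \near \oo, (up_log 2 m)%:R <= e * m%:R.
Proof.
move=> e0; pose K := Num.truncn (4 / e); exists (2 ^ K.+1)%N => // m /= Km.
set v := up_log 2 m.
have m1 : (1 < m)%N by apply: leq_trans Km; rewrite -[2%N]/(2 ^ 1)%N leq_exp2l.
have Kv : (K < v)%N by rewrite -(@up_expnK 2 K.+1) // leq_up_log.
have /andP[vm _] := up_log_bounds (isT : (1 < 2)%N) m1.
have v4 : (v ^ 2 <= 4 * m)%N.
  apply: leq_trans (sqr_le_exp2 v) _; rewrite -[v]prednK ?(leq_trans _ Kv) //.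
  by rewrite expnS mulnA leq_mul2l /= ltnW.
have v0 : 0 < v%:R :> R by rewrite ltr0n (leq_trans _ Kv).
have ev : 4 <= e * v%:R.
  rewrite -ler_pdivrMl // mulrC; apply/ltW/(lt_le_trans (truncnS_gt _)).
  by rewrite ler_nat.
rewrite -(ler_pM2l v0); apply: (@le_trans _ _ (4 * m%:R)).
  by rewrite -!natrM ler_nat mulnn.
by rewrite mulrA [v%:R * e]mulrC ler_wpM2r.
Qed.

End Log2.

(** * Exponential estimates *)

Section Exponential.
Variable R : realType.

Lemma onemX_le_expR (p : R) l : p <= 1 -> (1 - p) ^+ l <= expR (- (p * l%:R)).
Proof.
move=> p1; rewrite -mulNr mulrC expRM_natl.
by rewrite lerXn2r ?nnegrE ?subr_ge0 ?expR_ge0 // expR_ge1Dx.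
Qed.

(** Apply 1 + x <= e^x to 1/(1 - p) = 1 + p/(1 - p). For small [p] this matches the upper bound
    [onemX_le_expR]. *)
Lemma expR_le_onemX (p : R) l : p < 1 -> expR (- (p * l%:R / (1 - p))) <= (1 - p) ^+ l.
Proof.
move=> p1; have q0 : 0 < 1 - p by rewrite subr_gt0.
rewrite -mulrA [l%:R / _]mulrC mulrA -mulNr mulrC expRM_natl.
rewrite lerXn2r ?nnegrE ?expR_ge0 ?(ltW q0) // expRN -[leRHS]invrK.
rewrite lef_pV2 ?posrE ?expR_gt0 ?invr_gt0 //.
apply: le_trans (expR_ge1Dx _).
have e : (1 - p)^-1 = 1 + p / (1 - p) by field; rewrite gt_eqF.
by rewrite {1}e.
Qed.

Lemma mul_ln2_le_pow2 (x : R) : x * ln 2 <= 2 `^ x.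
Proof.
rewrite /powR (negbTE (_ : 2 != 0)) //; apply: le_trans (expR_ge1Dx _); lra.
Qed.

Lemma pow2_opp_near_le (d e : R) : 0 < d -> 0 < e -> \forall n \near \oo, 2 `^ (- (n%:R * d)) <= e.
Proof.
move=> d0 e0; exists (Num.truncn (e^-1 / (d * ln 2))).+1 => // n /= Nn.
rewrite powRN invf_ple ?posrE ?powR_gt0 //; apply: le_trans (mul_ln2_le_pow2 _).
rewrite -mulrA -ler_pdivrMr ?mulr_gt0 ?ln2_gt0 //.
by apply/ltW/(lt_le_trans (truncnS_gt _)); rewrite ler_nat.
Qed.

End Exponential.

(** * Limits of window probabilities for window lengths near log n *)

Section Asymptotics.
Variables (R : realType) (p : nat -> R) (alpha : R).
Hypothesis p01 : forall n : nat, (0 < n)%N -> 0 < p n < 1.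
Hypothesis pa : (fun n : nat => p n * (ln (n%:R : R) / ln (2 : R))) @ \oo --> alpha.

Let L n : R := ln n%:R / ln 2.

(** The product is (p log n)(f / log n), with factors tending to [alpha] and 0. It discards rounding
    and log log n corrections to the window length. *)
Lemma cvg_over_log2 (f : nat -> R) :
  (forall e : R, 0 < e -> \forall n \near \oo, `|f n| <= e * (trunc_log 2 n)%:R) ->
  p n * f n @[n --> \oo] --> (0 : R).
Proof.
move=> fe; rewrite -[0](mulr0 alpha).
have fL : f n / L n @[n --> \oo] --> (0 : R).
  apply/cvgr0Pnorm_le => e e0; near=> n.
  have n0 : (0 < n)%N by near: n; exists 1%N.
  have L0 : 0 < L n.
    apply: lt_le_trans (trunc_log_le_log2 R n n0); rewrite ltr0n.
    by near: n; exact: trunc_log_near.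
  rewrite normrM normfV (gtr0_norm L0) ler_pdivrMr //.
  apply: (@le_trans _ _ (e * (trunc_log 2 n)%:R)); first by near: n; exact: fe.
  by rewrite ler_pM2l //; exact: trunc_log_le_log2.
apply: cvg_trans (cvgM pa fL); apply: near_eq_cvg; near=> n.
have n0 : (0 < n)%N by near: n; exists 1%N.
have L0 : 0 < L n.
  apply: lt_le_trans (trunc_log_le_log2 R n n0); rewrite ltr0n.
  by near: n; exact: trunc_log_near.
rewrite /= -/(L n); field; exact: lt0r_neq0.
Unshelve. all: by end_near. Qed.

Lemma cvg_p0 : p n @[n --> \oo] --> (0 : R).
Proof.
have : p n * 1 @[n --> \oo] --> (0 : R).
  apply: (cvg_over_log2 (fun=> 1)) => e e0; near=> n.
  rewrite normr1 -ler_pdivrMl // mulr1.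
  apply/ltW/(lt_le_trans (truncnS_gt _)); rewrite ler_nat.
  by near: n; exact: trunc_log_near.
by under eq_fun do rewrite mulr1.
Unshelve. all: by end_near. Qed.

Lemma pow_up_log_near_ge e : 0 < e ->
  \forall n \near \oo, expR (- alpha) - e <= (1 - p n) ^+ up_log 2 n.
Proof.
move=> e0.
have : expR (- ((p n * L n + p n) / (1 - p n))) @[n --> \oo] --> expR (- ((alpha + 0) / (1 - 0))).
  apply: continuous_cvg; first exact: continuous_expR.
  apply: cvgN; apply: cvgM; first exact: cvgD pa cvg_p0.
  apply: cvgV; first by rewrite subr0.
  by apply: cvgB; [exact: cvg_cst|exact: cvg_p0].
rewrite addr0 subr0 divr1 => /cvgr_ge h.
near=> n; have n1 : (1 < n)%N by near: n; exists 2%N.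
have /andP[pn0 pn1] := p01 n (ltnW n1).
apply: le_trans _ (expR_le_onemX _ _ _ pn1).
apply: (@le_trans _ _ (expR (- ((p n * L n + p n) / (1 - p n))))).
  by near: n; apply: h; rewrite gtrBl.
rewrite ler_expR lerN2 ler_pM2r ?invr_gt0 ?subr_gt0 //.
by rewrite -[X in _ + X]mulr1 -mulrDr ler_pM2l // up_log_le_log2.
Unshelve. all: by end_near. Qed.

Let b n := up_log 2 (trunc_log 2 n).+1.

Lemma up_log_trunc_log_small (e : R) : 0 < e -> \forall n \near \oo, (b n)%:R <= e * (trunc_log 2 n)%:R.
Proof.
move=> e0; have e2 : 0 < e / 2 by rewrite divr_gt0.
have [N _ hN] := up_log_small R _ e2.
near=> n; apply: le_trans (hN _ _) _.
  by rewrite /= ltnW // ltnS; near: n; exact: trunc_log_near.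
have : (1 : R) <= (trunc_log 2 n)%:R by rewrite ler1n; near: n; exact: trunc_log_near.
rewrite -[(trunc_log 2 n).+1%:R]natr1 => a1; set a := (_)%:R in a1 *; nra.
Unshelve. all: by end_near. Qed.

(** The length is at least log n - 1 - 4 b, and [cvg_over_log2] makes the correction
    [p n * (1 + 4 * b n)] vanish. *)
Lemma pow_short_length_near_le (e : R) : 0 < e -> \forall n \near \oo,
  (4 * b n <= trunc_log 2 n)%N /\
  (1 - p n) ^+ (trunc_log 2 n - 4 * b n) <= expR (- alpha) + e.
Proof.
move=> e0.
have : expR (- (p n * L n - p n * (1 + 4 * (b n)%:R))) @[n --> \oo] --> expR (- (alpha - 0)).
  apply: continuous_cvg; first exact: continuous_expR.
  apply: cvgN; apply: cvgB; first exact: pa.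
  apply: cvg_over_log2 => d d0; near=> n.
  rewrite ger0_norm ?addr_ge0 ?mulr_ge0 //.
  have : (b n)%:R <= d / 8 * (trunc_log 2 n)%:R.
    by near: n; apply: up_log_trunc_log_small; rewrite divr_gt0.
  have : 2 / d <= (trunc_log 2 n)%:R.
    apply/ltW/(lt_le_trans (truncnS_gt _)); rewrite ler_nat.
    by near: n; exact: trunc_log_near.
  rewrite ler_pdivrMr //; lra.
rewrite subr0 => /cvgr_le h.
near=> n.
have n0 : (0 < n)%N by near: n; exists 1%N.
have /andP[pn0 pn1] := p01 n n0.
have ba : (4 * b n <= trunc_log 2 n)%N.
  rewrite -(ler_nat R) natrM -ler_pdivlMl // .
  by near: n; apply: up_log_trunc_log_small; rewrite invr_gt0.
split => //; apply: le_trans (onemX_le_expR _ _ _ (ltW pn1)) _.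
apply: le_trans (_ : _ <= expR (- (p n * L n - p n * (1 + 4 * (b n)%:R)))) _; last first.
  by near: n; apply: h; rewrite ltrDl.
rewrite ler_expR lerN2 -mulrBr ler_pM2l // natrB // natrM.
have := log2_le_trunc_log R n n0; rewrite -/(L n); lra.
Unshelve. all: by end_near. Qed.

End Asymptotics.

(** * Capacity *)

Lemma achievable_le (R : realType) (p : nat -> R) r r' :
  r <= r' -> achievable p r' -> achievable p r.
Proof.
move=> rr' ach eps eps0; have [N hN] := ach eps eps0.
exists N => n /hN[C [CM Ce]]; exists C; split => //.
by apply: le_trans CM; apply: ler_powR; rewrite ?ler1n // ler_wpM2l.
Qed.

Section Capacity.
Variables (R : realType) (p : nat -> R) (alpha : R).
Hypothesis p01 : forall n : nat, (0 < n)%N -> 0 < p n < 1.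
Hypothesis pa : (fun n : nat => p n * (ln (n%:R : R) / ln (2 : R))) @ \oo --> alpha.

Lemma achievable_lt_nneg r : 0 <= r -> r < expR (- alpha) -> achievable p r.
Proof.
set c := expR _ => r0 rc eps eps0.
(* The gap [c - r] is spent in four parts [d]: on the limit of [(1 - p n) ^ l], on replacing [n - l]
   by [n], on the Chebyshev deviation, and on the surplus of [s0] over [n r]. *)
pose d := (c - r) / 4; have d0 : 0 < d by rewrite divr_gt0 ?subr_gt0.
suff [N _ hN] : \forall n \near \oo, exists C : Defs.code n,
    2 `^ (n%:R * r) <= (nmsg C)%:R /\ err (p n) C <= eps by exists N.
near=> n.
have n1 : (1 < n)%N by near: n; exists 2%N.
have n0 : 0 < n%:R :> R by rewrite ltr0n ltnW.
have /andP[pn0 pn1] := p01 n (ltnW n1).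
have qc : c - d <= (1 - p n) ^+ up_log 2 n.
  by near: n; exact: (pow_up_log_near_ge R p alpha p01 pa d d0).
have ld : (up_log 2 n)%:R <= d * n%:R by near: n; exact: up_log_small.
have leps : (up_log 2 n)%:R <= (eps * d ^+ 2 / 4) * n%:R.
  by near: n; apply: up_log_small; apply: divr_gt0 => //; apply: mulr_gt0 => //; exact: exprn_gt0.
have pw : 2 `^ (- (n%:R * d)) <= eps / 4.
  by near: n; apply: pow2_opp_near_le => //; exact: divr_gt0.
set l := up_log 2 n in qc ld leps.
have l0 : (0 < l)%N by rewrite up_log_gt0.
(* The [m + 1] messages number more than 2^(nr), and at most twice as many because [r >= 0] makes
   2^(nr) at least 1. *)
pose m := Num.truncn (2 `^ (n%:R * r)); pose s0 := n%:R * (r + d).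
have x1 : 1 <= 2 `^ (n%:R * r).
  rewrite -[leLHS](powRr0 2); apply: ler_powR; rewrite ?ler1n // mulr_ge0 //.
have /andP[mx xm] := @truncn_itv _ (2 `^ (n%:R * r)) (powR_ge0 _ _).
have [C [CM Ce]] := exists_code R (p n) n l s0 m (ltW pn0) (ltW pn1) l0 (@up_logP 2 n isT).
exists C; rewrite CM; split; first exact: ltW.
apply: le_trans Ce _; rewrite [leRHS](splitr eps); apply: lerD.
  have t0 : 0 < n%:R * d by rewrite mulr_gt0.
  have := nwin_lower_tail R (p n) n (ltW pn0) (ltW pn1) l (n%:R * d) t0.
  set mu := (n - l)%:R * _ => tail.
  apply: (@le_trans _ _ ((n * (2 * l))%:R / (n%:R * d) ^+ 2)); last first.
    rewrite ler_pdivrMr ?exprn_gt0 // !natrM.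
    have : n%:R * l%:R <= n%:R * (eps * d ^+ 2 / 4 * n%:R) by rewrite ler_pM2l.
    lra.
  apply: le_trans tail; apply: ler_sum => T _.
  apply: ler_wpM2l; first by rewrite tear_prob_ge0 ?ltW.
  case: (ltP _ s0) => //= lts.
  suff -> : (nwin l T)%:R <= mu - n%:R * d by [].
  apply: le_trans (ltW lts) _; rewrite /s0 lerBrDr /mu.
  have le_ln : (l <= n)%N by rewrite up_log_min // ltnW // ltn_expl.
  rewrite natrB // mulrBl.
  have : l%:R * (1 - p n) ^+ l <= l%:R * 1.
    by rewrite ler_wpM2l // exprn_ile1 // ?subr_ge0 ?gerBl ltW.
  have : n%:R * (c - d) <= n%:R * (1 - p n) ^+ l by rewrite ler_pM2l.
  have : c = r + 4 * d by rewrite /d; field.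
  move=> ->; lra.
apply: (@le_trans _ _ (2 * 2 `^ (n%:R * r) * 2 `^ (- s0))).
  rewrite ler_wpM2r ?powR_ge0 // -natr1; lra.
rewrite -mulrA -powRD; last by rewrite pnatr_eq0 implybT.
rewrite (_ : n%:R * r - s0 = - (n%:R * d)); last by rewrite /s0; ring.
lra.
Unshelve. all: by end_near. Qed.

Lemma achievable_lt r : r < expR (- alpha) -> achievable p r.
Proof.
move=> rc; apply: (achievable_le _ _ _ (Num.max r 0)); first by rewrite le_max lexx.
apply: achievable_lt_nneg; first by rewrite le_max lexx orbT.
by rewrite gt_max rc expR_gt0.
Qed.

Lemma achievable_ub r : achievable p r -> r <= expR (- alpha).
Proof.
set c := expR _ => ach; rewrite leNgt; apply/negP => cr.
have c0 : 0 < c := expR_gt0 _.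
pose d := (r - c) / 4; have d0 : 0 < d by rewrite divr_gt0 ?subr_gt0.
have rE : r = c + 4 * d by rewrite /d; field.
(* With threshold n(r - 2d) = n(c + 2d), the Markov term is at most (c + d)/(c + 2d) = 1 - 4e and
   the counting term at most [e], so the error is at least 3e, contradicting the bound [e]. *)
pose e := d / (4 * (r - 2 * d)).
have rd : 0 < r - 2 * d by lra.
have e0 : 0 < e by apply: divr_gt0 => //; exact: mulr_gt0.
have [N hN] := ach e e0.
near \oo => n.
have n0 : 0 < n%:R :> R by rewrite ltr0n; near: n; exists 1%N.
have /andP[pn0 pn1] := p01 n (eq_ind _ is_true n0 _ (ltr0n R n)).
have [|C [CM Ce]] := hN n; first by near: n; exists N.
have [ba qc] : (4 * up_log 2 (trunc_log 2 n).+1 <= trunc_log 2 n)%N /\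
    (1 - p n) ^+ (trunc_log 2 n - 4 * up_log 2 (trunc_log 2 n).+1) <= c + d.
  by near: n; exact: (pow_short_length_near_le R p alpha p01 pa d d0).
have bs : (up_log 2 (trunc_log 2 n).+1)%:R <= 8^-1 * (trunc_log 2 n)%:R :> R by near: n; exact: up_log_trunc_log_small.
have ad : 4 / d <= (trunc_log 2 n)%:R.
  apply/ltW/(lt_le_trans (truncnS_gt _)); rewrite ler_nat.
  by near: n; exact: trunc_log_near.
set a := trunc_log 2 n in ba qc bs ad; set b := up_log 2 a.+1 in ba qc bs.
set l := (a - 4 * b)%N in qc.
have lE : l%:R = a%:R - 4 * b%:R :> R by rewrite natrB // natrM.
(* This makes the [2 * (n %/ l)] bits of [key_count_exponent] at most [n d]. *)
have ld : 2 / d <= l%:R by rewrite lE; move: ad bs; rewrite !ler_pdivrMr //; nra.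
have l0 : (0 < l)%N by rewrite -(ltr0n R); apply: lt_le_trans ld; rewrite divr_gt0.
have pw : 2 `^ (- (n%:R * d)) <= e by near: n; exact: pow2_opp_near_le.
have t0 : 0 < n%:R * (r - 2 * d) by rewrite mulr_gt0.
have := err_lower_bound R (p n) (n%:R * (r - 2 * d)) n l C (ltW pn0) (ltW pn1) l0 t0.
set A := (_ * 2 ^ (n %/ l))%N.
have A2 : A%:R <= 2 `^ (n%:R * d) :> R.
  apply: (@le_trans _ _ (2 ^ (2 * (n %/ l)))%:R).
    by rewrite ler_nat; apply: (key_count_exponent n l b) => //; rewrite subnK.
  rewrite natrX -powR_mulrn //; apply: ler_powR; rewrite ?ler1n // natrM.
  have : (n %/ l)%:R * l%:R <= n%:R :> R by rewrite -natrM ler_nat leq_trunc_div.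
  have := ler0n R (n %/ l); move: ld; rewrite ler_pdivrMr //.
  set k := (n %/ l)%:R; nra.
have M0 : 0 < (nmsg C)%:R :> R by rewrite ltr0n nmsg_gt0.
have t2 : A%:R * 2 `^ (n%:R * (r - 2 * d)) / (nmsg C)%:R <= e.
  apply: le_trans pw; rewrite ler_pdivrMr //.
  apply: (@le_trans _ _ (2 `^ (- (n%:R * d)) * 2 `^ (n%:R * r))); last first.
    by rewrite ler_wpM2l ?powR_ge0.
  apply: (@le_trans _ _ (2 `^ (n%:R * d) * 2 `^ (n%:R * (r - 2 * d)))).
    by rewrite ler_wpM2r ?powR_ge0.
  rewrite -!powRD ?pnatr_eq0 ?implybT //.
  by rewrite (_ : _ + n%:R * _ = - (n%:R * d) + n%:R * r) //; ring.
have t1 : (n - l)%:R * (1 - p n) ^+ l / (n%:R * (r - 2 * d)) <= 1 - 4 * e.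
  have -> : 1 - 4 * e = (n%:R * (c + d)) / (n%:R * (r - 2 * d)).
    by rewrite /e rE; field; rewrite -rE !lt0r_neq0.
  rewrite ler_wpM2r ?invr_ge0 ?(ltW t0) //.
  apply: ler_pM => //; first by rewrite exprn_ge0 // subr_ge0 ltW.
  by rewrite ler_nat leq_subr.
lra.
Unshelve. all: by end_near. Qed.

End Capacity.

Theorem theorem1 (R : realType) (p : nat -> R) (alpha : R) :
  (forall n : nat, (0 < n)%N -> 0 < p n < 1) ->
  (fun n : nat => p n * (ln (n%:R : R) / ln (2 : R))) @ \oo --> alpha ->
  capacity p = expR (- alpha).
Proof.
move=> p01 pa.
have ub : ubound [set r | achievable p r] (expR (- alpha)).
  by move=> r; exact: (achievable_ub _ _ _ p01 pa).
apply/eqP; rewrite eq_le; apply/andP; split.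
  apply: ge_sup ub; exists (expR (- alpha) - 1).
  by apply: (achievable_lt _ _ _ p01 pa); rewrite gtrBl.
rewrite leNgt; apply/negP => lt.
(* The midpoint would be an achievable rate above the supremum. *)
have [sr rc] := midf_lt lt.
have := ub_le_sup (ex_intro _ _ ub) (achievable_lt _ _ _ p01 pa _ rc).
by rewrite leNgt sr.
Qed.
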